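(* Let $u$ be an axisymmetric Navier–Stokes solution on $\mathbb R^3\times[0,T)$ whose circulation $\Gamma=ru^\theta$ satisfies $\|\Gamma(t)\|_{L^\infty}\le\Gamma_*$ with $0<\Gamma_*<\infty$. Let $x_*=(0,0,z_* )$ be a point on the symmetry axis, $R>0$ and $B_R=B_R(x_* )$. At every regular time $t$, $$S_R\le2\pi\Gamma_*^2\log\!\left(1+\frac{R\,D_{\theta,R}}{2\pi\Gamma_*^2}\right).$$ Consequently, $$\int_{B_R}|\nabla u|^2\,dx\ge\frac{2\pi\Gamma_*^2}{R}\left[\exp\!\left(\frac{A_R^2-M_R}{2\pi\Gamma_*^2}\right)-1\right].$$
   Context: $u=u^re_r+u^\theta e_\theta+u^ze_z$ in cylindrical coordinates, $u^{\rm mer}=u^re_r+u^ze_z$, $r$ is the distance to the axis. At time $t$ define $$A_R(t)^2=\frac1R\int_{B_R}|u|^2dx,\quad M_R(t)=\frac1R\int_{B_R}|u^{\rm mer}|^2dx,\quad S_R(t)=A_R(t)^2-M_R(t)=\frac1R\int_{B_R}|u^\theta|^2dx,$$ $$D_{\theta,R}(t)=\int_{B_R}\frac{|u^\theta(x,t)|^2}{r^2}\,dx .$$ A regular time is a time at which $u(\cdot,t)$ is smooth. *)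

(* Defs.v *)
From HB Require Import structures.
From mathcomp Require Import all_boot all_order all_algebra.
From mathcomp Require Import all_classical all_reals all_analysis.
From mathcomp Require Import measurable_realfun.
Import Order.TTheory GRing.Theory Num.Theory.
Import numFieldNormedType.Exports.

Set Implicit Arguments.
Unset Strict Implicit.
Unset Printing Implicit Defensive.

Local Open Scope classical_set_scope.
Local Open Scope ring_scope.

(** Points and vectors of R^3 are row vectors. The library norm on ['rV[R]_3]
    is the sup norm, hence the explicit Euclidean quantities. *)

Section Euclidean.
Context {R : realType}.

Definition vec3 (a b c : R) : 'rV[R]_3 := \row_(i < 3) [:: a; b; c]`_i.

Definition basis (i : 'I_3) : 'rV[R]_3 := delta_mx 0 i.

Definition dotv (v w : 'rV[R]_3) : R := \sum_(i < 3) v 0 i * w 0 i.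

Definition normsq (v : 'rV[R]_3) : R := dotv v v.

Definition eball (x0 : 'rV[R]_3) (rho : R) : set 'rV[R]_3 :=
  [set x | normsq (x - x0) < rho ^+ 2].

End Euclidean.

Notation triple R :=
  (measurableTypeR R * measurableTypeR R * measurableTypeR R)%type.

(** The library has no measurable structure on ['rV[R]_3]: Lebesgue measure on
    R^3 is the product measure on triples, and integrals over ['rV[R]_3] are
    pulled back along the coordinates. *)

Section Integration.
Context {R : realType}.

Lemma sigma_finite_prod d1 d2 (T1 : measurableType d1) (T2 : measurableType d2)
    (m1 : {sigma_finite_measure set T1 -> \bar R})
    (m2 : {sigma_finite_measure set T2 -> \bar R}) :
  sigma_finite setT (m1 \x m2)%E.
Proof.
have /sigma_finiteP[F [TF ndF Foo]] := sigma_finiteT m1.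
have /sigma_finiteP[G [TG ndG Goo]] := sigma_finiteT m2.
exists (fun n => F n `*` G n).
  rewrite -setXTT TF TG predeqE => -[x y]; split.
    move=> [/= [n _ Fnx] [k _ Gky]]; exists (maxn n k) => //; split.
    - by move: x Fnx; exact/subsetPset/ndF/leq_maxl.
    - by move: y Gky; exact/subsetPset/ndG/leq_maxr.
  by move=> [n _ []/= ? ?]; split; exists n.
move=> k; have [? ?] := Foo k; have [? ?] := Goo k.
split; first exact: measurableX.
by rewrite product_measure1E// lte_mul_pinfty// ge0_fin_numE.
Qed.

Definition of_triple (p : R * R * R) : 'rV[R]_3 := vec3 p.1.1 p.1.2 p.2.

Definition leb2 := (@lebesgue_measure R \x @lebesgue_measure R)%E.
HB.instance Definition _ := Measure.on leb2.
HB.instance Definition _ := Measure_isSigmaFinite.Build _ _ _ leb2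
  (sigma_finite_prod _ _).

Definition leb3 := (leb2 \x @lebesgue_measure R)%E.
HB.instance Definition _ := Measure.on leb3.
HB.instance Definition _ := Measure_isSigmaFinite.Build _ _ _ leb3
  (sigma_finite_prod _ _).

(* Lebesgue measure on space-time R x R^3 *)
Definition leb13 := (@lebesgue_measure R \x leb3)%E.
HB.instance Definition _ := Measure.on leb13.
HB.instance Definition _ := Measure_isSigmaFinite.Build _ _ _ leb13
  (sigma_finite_prod _ _).

Definition eintegral3 (D : set 'rV[R]_3) (f : 'rV[R]_3 -> R) : \bar R :=
  (\int[leb3]_(p in of_triple @^-1` D) (f (of_triple p))%:E)%E.

Definition integral3 (D : set 'rV[R]_3) (f : 'rV[R]_3 -> R) : R :=
  fine (eintegral3 D f).

Definition Linfty3 (f : 'rV[R]_3 -> R) : \bar R :=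
  Lnorm leb3 +oo%E (fun p => (f (of_triple p))%:E).

Definition eintegral13 (I : set R) (D : set 'rV[R]_3)
    (f : R * 'rV[R]_3 -> R) : \bar R :=
  (\int[leb13]_(q in [set q | I q.1 /\ D (of_triple q.2)])
     (f (q.1, of_triple q.2))%:E)%E.

Definition integral13 (I : set R) (D : set 'rV[R]_3)
    (f : R * 'rV[R]_3 -> R) : R := fine (eintegral13 I D f).

End Integration.

Section Smoothness.
Context {R : realType}.

(* Used with [V] finite-dimensional, where this is the usual class C^k. *)
Fixpoint Ck (V W : normedModType R) (k : nat) (f : V -> W) : Prop :=
  match k with
  | 0 => continuous f
  | k'.+1 => (forall x, differentiable f x) /\ (forall v, Ck k' ('D_v f))
  end.

Definition smooth (V W : normedModType R) (f : V -> W) : Prop :=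
  forall k, Ck k f.

Definition test_function (V W : normedModType R) (f : V -> W) : Prop :=
  smooth f /\ exists2 K : set V, compact K & forall x, ~ K x -> f x = 0.

End Smoothness.

Section NavierStokes.
Context {R : realType}.

(* On space-time R x R^3 *)
Definition time_dir : R * 'rV[R]_3 := (1, 0).
Definition space_dir (v : 'rV[R]_3) : R * 'rV[R]_3 := (0, v).

Definition dt (phi : R * 'rV[R]_3 -> 'rV[R]_3) := 'D_time_dir phi.

Definition laplacian (phi : R * 'rV[R]_3 -> 'rV[R]_3)
    (q : R * 'rV[R]_3) : 'rV[R]_3 :=
  \sum_(i < 3) 'D_(space_dir (basis i)) ('D_(space_dir (basis i)) phi) q.

Definition divergence (phi : R * 'rV[R]_3 -> 'rV[R]_3)
    (q : R * 'rV[R]_3) : R :=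
  \sum_(i < 3) ('D_(space_dir (basis i)) phi q) 0 i.

Definition solenoidal_test (phi : R * 'rV[R]_3 -> 'rV[R]_3) : Prop :=
  test_function phi /\ forall q, divergence phi q = 0.

(** Weak solutions of
      d_t u + (u . grad) u + grad p = nu Delta u,   div u = 0
    on R^3 x [0, T), with initial value [u 0]. The pressure is eliminated by
    testing against divergence-free fields. The identity is required between
    times 0 and t for every t < T, so that every time slice [u t] is tied to
    the equation. No energy bound is imposed: classical, mild and
    (weakly continuous) Leray-Hopf solutions are instances. *)
Record NS_solution (nu T : R) (u : R -> 'rV[R]_3 -> 'rV[R]_3) : Prop := {
  NS_viscosity : 0 < nu ;
  NS_lifespan : 0 < T ;
  NS_measurable : forall i : 'I_3,
    measurable_fun [set q : (measurableTypeR R * triple R)%type | 0 <= q.1 < T]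
      (fun q => u q.1 (of_triple q.2) 0 i : measurableTypeR R) ;
  NS_slice_L2loc : forall t rho : R, 0 <= t < T ->
    (eintegral3 (eball 0%R rho) (fun x => normsq (u t x)) < +oo)%E ;
  NS_L2loc : forall t rho : R, 0 <= t < T ->
    (eintegral13 `[0%R, t] (eball 0%R rho) (fun q => normsq (u q.1 q.2)) < +oo)%E ;
  NS_divfree : forall t : R, 0 <= t < T ->
    forall psi : 'rV[R]_3 -> R, test_function psi ->
    integral3 setT (fun x => 'D_(u t x) psi x) = 0 ;
  NS_momentum : forall t : R, 0 <= t < T ->
    forall phi : R * 'rV[R]_3 -> 'rV[R]_3, solenoidal_test phi ->
    integral3 setT (fun x => dotv (u t x) (phi (t, x)))
    = integral3 setT (fun x => dotv (u 0 x) (phi (0, x)))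
      + integral13 `[0, t] setT (fun q =>
          let v := u q.1 q.2 in
          dotv v (dt phi q) + dotv v ('D_(space_dir v) phi q)
          + nu * dotv v (laplacian phi q))
}.

Definition regular_time (T : R) (u : R -> 'rV[R]_3 -> 'rV[R]_3) (t : R) : Prop :=
  0 <= t < T /\ smooth (u t).

End NavierStokes.

Section Cylindrical.
Context {R : realType}.

(* The coordinates x, y, z are numbered 0, 1, 2. *)
Definition zcoord (x : 'rV[R]_3) : R := x 0 2%R.

Definition raxis (x : 'rV[R]_3) : R :=
  Num.sqrt (x 0 0 ^+ 2 + x 0 1 ^+ 2).

(* On the axis, where the frame is undefined, the convention y / 0 = 0 makes
   [e_r] and [e_theta] vanish. *)
Definition e_r (x : 'rV[R]_3) : 'rV[R]_3 :=
  vec3 (x 0 0 / raxis x) (x 0 1 / raxis x) 0.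

Definition e_theta (x : 'rV[R]_3) : 'rV[R]_3 :=
  vec3 (- (x 0 1) / raxis x) (x 0 0 / raxis x) 0.

Definition e_z : 'rV[R]_3 := vec3 0 0 1.

Implicit Types v : 'rV[R]_3 -> 'rV[R]_3.

Definition comp_r v x : R := dotv (v x) (e_r x).
Definition comp_theta v x : R := dotv (v x) (e_theta x).
Definition comp_z v x : R := dotv (v x) e_z.

(* The cylindrical components, defined off the axis, depend on r and z only. *)
Definition axisymmetric v : Prop :=
  forall x y, 0 < raxis x -> raxis x = raxis y -> zcoord x = zcoord y ->
  [/\ comp_r v x = comp_r v y, comp_theta v x = comp_theta v y
    & comp_z v x = comp_z v y].

Definition meridional v x : 'rV[R]_3 :=
  comp_r v x *: e_r x + comp_z v x *: e_z.

Definition circulation v x : R := raxis x * comp_theta v x.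

(* Squared Frobenius norm of the gradient. *)
Definition gradsq v x : R := \sum_(j < 3) normsq ('D_(basis j) v x).

Definition A_ v (x0 : 'rV[R]_3) (rho : R) : R :=
  Num.sqrt (rho^-1 * integral3 (eball x0 rho) (fun x => normsq (v x))).

Definition M_ v (x0 : 'rV[R]_3) (rho : R) : R :=
  rho^-1 * integral3 (eball x0 rho) (fun x => normsq (meridional v x)).

Definition S_ v (x0 : 'rV[R]_3) (rho : R) : R :=
  A_ v x0 rho ^+ 2 - M_ v x0 rho.

Definition D_theta v (x0 : 'rV[R]_3) (rho : R) : R :=
  integral3 (eball x0 rho) (fun x => comp_theta v x ^+ 2 / raxis x ^+ 2).

End Cylindrical.

(* Main.v *)
Require Import Defs.
From HB Require Import structures.
From mathcomp Require Import all_boot all_order all_algebra.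
From mathcomp Require Import all_classical all_reals all_analysis.
From mathcomp Require Import measurable_realfun ess_sup_inf ring lra.
Import Order.TTheory GRing.Theory Num.Theory.
Import numFieldNormedType.Exports.

Local Open Scope classical_set_scope.
Local Open Scope ring_scope.

(** Write g = |u^theta|^2 / r^2, G for the bound on the circulation, and let q
    be in (0, R^2]. Since g <= G^2 / r^4, one has
    |u^theta|^2 = r^2 g <= q g + G^2 (r^2 - q)^+ / r^4. Integrate over the ball:
    the first term gives q D, and the second is at most its integral over the
    circumscribed cylinder of radius and half-height R. As r^2 pushes the planar
    Lebesgue measure forward to pi dq on the half-line, that integral is
    2 pi R G^2 (log (R^2 / q) - 1 + q / R^2). The choice
    R^2 / q = 1 + R D / (2 pi G^2) gives the logarithmic bound.
    For the gradient, differentiating u (Rot_a x) = Rot_a (u x) at a = 0 yields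
    - x_1 d_0 u + x_0 d_1 u = (- u_1, u_0, 0), so |grad u|^2 >= g by
    Cauchy-Schwarz, and the first bound is solved for D. *)

(** * Measurability *)

Section MeasurabilityOfContinuous.
Context {R : realType}.

Let rbox (q : (rat * rat) * (rat * rat) * (rat * rat)) : set (triple R) :=
  (`](ratr q.1.1.1 : R), ratr q.1.1.2[%classic `*` `]ratr q.1.2.1, ratr q.1.2.2[%classic)
  `*` `]ratr q.2.1, ratr q.2.2[%classic.

Let nbhs_rat_itv (x : R) (B : set R) : nbhs x B ->
  exists q : rat * rat, (x \in `](ratr q.1), (ratr q.2)[) /\
    (`](ratr q.1), (ratr q.2)[%classic : set R) `<=` B.
Proof.
move=> /nbhs_ballP[e /= e0 eB].
have [a] : exists a : rat, ratr a \in `]x - e, x[.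
  by apply: rat_in_itvoo; rewrite ltrBlDr ltrDl.
have [b] : exists b : rat, ratr b \in `]x, x + e[.
  by apply: rat_in_itvoo; rewrite ltrDl.
rewrite !in_itv/= => /andP[xb be] /andP[ea ax].
exists (a, b); split; first by rewrite in_itv/= ax.
move=> y; rewrite /= in_itv/= => /andP[ay yb]; apply: eB.
by rewrite /ball/= ltr_distlC; apply/andP; split; lra.
Qed.

(** Neighbourhoods of a row vector are entrywise, so the open set is a union of boxes with rational
    endpoints, and there are countably many of these. *)
Lemma open_measurable_of_triple (U : set 'rV[R]_3) : open U ->
  measurable (of_triple @^-1` U : set (triple R)).
Proof.
move=> oU.
(* A box that leaves the preimage is replaced by the empty set, so that the union can run over all
   rational sextuples. *)
pose F q := if `[< rbox q `<=` of_triple @^-1` U >] then rbox q else set0.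
rewrite (_ : _ @^-1` _ = \bigcup_q F q).
  apply: countable_bigcupT_measurable; first exact: countableP.
  move=> q; rewrite /F; case: asboolP => _; last exact: measurable0.
  apply: (@measurableX _ _ (measurableTypeR R * measurableTypeR R)%type
    (measurableTypeR R)); last exact: measurable_itv.
  by apply: measurableX; exact: measurable_itv.
apply/seteqP; split => [[[x y] z] /= Up|p [q _]]; last first.
  by rewrite /F; case: asboolP => // sub; exact: sub.
have : nbhs (of_triple (x, y, z)) U by move: oU; rewrite openE; apply.
move=> [B nB BU].
have [q0 [xq0 q0B]] := nbhs_rat_itv _ _ (nB ord0 0).
have [q1 [yq1 q1B]] := nbhs_rat_itv _ _ (nB ord0 1).
have [q2 [zq2 q2B]] := nbhs_rat_itv _ _ (nB ord0 2%R).
rewrite !mxE/= in xq0 yq1 zq2.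
exists (q0, q1, q2) => //.
rewrite /F; case: asboolP => [_|[]]; first by [].
move=> [[x' y'] z'] [[/= x'0 y'1] z'2]; apply: BU => i j.
rewrite ord1 mxE; case: j => -[|[|[|//]]] j3 /=.
- by rewrite (_ : Ordinal _ = 0); [exact: q0B|exact: val_inj].
- by rewrite (_ : Ordinal _ = 1); [exact: q1B|exact: val_inj].
- by rewrite (_ : Ordinal _ = 2); [exact: q2B|exact: val_inj].
Qed.

Lemma continuous_measurable_of_triple (f : 'rV[R]_3 -> R) : continuous f ->
  measurable_fun setT (f \o of_triple : triple R -> measurableTypeR R).
Proof.
move=> cf.
apply: (measurability _ (RGenOpens.measurableE R)).
move=> _ [_ [a [b ->] <-]]; rewrite setTI comp_preimage.
apply: open_measurable_of_triple.
by move/continuousP : cf; apply; exact: interval_open.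
Qed.

End MeasurabilityOfContinuous.

(** * Lebesgue measure in cylindrical coordinates *)

Section Disc.
Context {R : realType}.
Local Notation mu := (@lebesgue_measure R).

Lemma asin_pihalf : @asin R 1 = pi / 2.
Proof.
rewrite -[RHS]sinK ?sin_pihalf// in_itv/= lexx andbT.
by rewrite (@le_trans _ _ 0)// ?oppr_le0 divr_ge0// pi_ge0.
Qed.

Lemma asinN_pihalf : @asin R (-1) = - (pi / 2).
Proof.
rewrite -[RHS]sinK ?sinN ?sin_pihalf// in_itv/= lexx /=.
by rewrite (@le_trans _ _ 0)// ?oppr_le0 divr_ge0// pi_ge0.
Qed.

(** Continuity has to reach the endpoints, where arcsine is not differentiable. It comes from
    inverting the continuous map a sin t on [-pi/2, pi/2]. *)
Lemma within_continuous_asin_div (a : R) : 0 < a ->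
  {within `[-a, a], continuous (fun x => asin (x / a))}.
Proof.
move=> a0.
have pi2 : 0 <= pi / 2 :> R by rewrite divr_ge0// pi_ge0.
have := @segment_can_le_continuous R (- (pi / 2)) (pi / 2)
  (fun t => a * sin t) (fun x => asin (x / a)).
rewrite sinN sin_pihalf mulrN mulr1; apply.
- by rewrite (@le_trans _ _ 0)// oppr_le0.
- apply: continuous_subspaceT => x; apply: cvgM; first exact: cvg_cst.
  exact: continuous_sin.
- by move=> t tpi; rewrite mulrAC divff ?gt_eqF// mul1r sinK.
Qed.

(** The integrand is the length of the chord at abscissa x, so this is the area of a disc of radius
    a. The antiderivative [F] is differentiable inside the interval and merely continuous at its
    ends, which suffices for the fundamental theorem. *)
Lemma half_chord_integral (a : R) : 0 < a ->
  (\int[mu]_(x in `[(-a)%R, a]) (2 * Num.sqrt (a ^+ 2 - x ^+ 2))%:E =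
   (pi * a ^+ 2)%:E)%E.
Proof.
move=> a0.
pose F x := x * Num.sqrt (a ^+ 2 - x ^+ 2) + a ^+ 2 * asin (x / a).
have cs : continuous (fun x : R => Num.sqrt (a ^+ 2 - x ^+ 2)).
  move=> x; apply: continuous_comp; last exact: sqrt_continuous.
  by apply: cvgB; [exact: cvg_cst|exact: exprn_continuous].
have aa : - a < a by rewrite gtrN.
have cF : {within `[-a, a], continuous F}.
  have c1 : {within `[-a, a], continuous (fun x => x * Num.sqrt (a ^+ 2 - x ^+ 2))}.
    by apply: continuous_subspaceT => y; apply: cvgM; [exact: cvg_id|exact: cs].
  move=> x; apply: cvgD; first exact: c1.
  by apply: cvgM; [exact: cvg_cst|exact: within_continuous_asin_div].
have dF x : x \in `]-a, a[ -> is_derive x 1 F (2 * Num.sqrt (a ^+ 2 - x ^+ 2)).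
  rewrite in_itv/= => /andP[ax xa].
  have xa1 : -1 < x / a < 1.
    by rewrite ltr_pdivrMr// mul1r xa andbT ltr_pdivlMr// mulN1r.
  have s0 : 0 < a ^+ 2 - x ^+ 2.
    by rewrite subr_gt0 -subr_gt0 subr_sqr mulr_gt0//; lra.
  have da : is_derive x 1 (fun x => asin (x / a)) (a^-1 / Num.sqrt (1 - (x / a) ^+ 2)).
    have h : is_derive x 1 (fun x : R => x / a) a^-1.
      by apply: is_derive_eq; rewrite scaler0 add0r; exact: mulr1.
    have := @is_derive1_comp R asin (fun x => x / a) x _ _ (is_derive1_asin xa1) h.
    by rewrite mulrC.
  have ds : is_derive x 1 (fun x => Num.sqrt (a ^+ 2 - x ^+ 2))
     ((2 * Num.sqrt (a ^+ 2 - x ^+ 2))^-1 * (- (2 * x))).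
    apply: (@is_derive1_comp R Num.sqrt (fun x => a ^+ 2 - x ^+ 2)).
      exact: is_derive1_sqrt.
    by apply: is_derive_eq; rewrite /GRing.scale/=; ring.
  apply: is_derive_eq.
  rewrite /GRing.scale/=.
  have sx : Num.sqrt (a ^+ 2 - x ^+ 2) ^+ 2 = a ^+ 2 - x ^+ 2 by rewrite sqr_sqrtr// ltW.
  have -> : Num.sqrt (1 - (x / a) ^+ 2) = Num.sqrt (a ^+ 2 - x ^+ 2) / a.
    have -> : 1 - (x / a) ^+ 2 = (a ^+ 2 - x ^+ 2) * a^-1 ^+ 2.
      by field; rewrite gt_eqF.
    by rewrite sqrtrM ?ltW// sqrtr_sqr gtr0_norm ?invr_gt0.
  set s := Num.sqrt _ in sx *.
  have sn0 : s != 0 by rewrite gt_eqF// sqrtr_gt0.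
  transitivity (s + (a ^+ 2 - x ^+ 2) / s).
    by field; rewrite sn0 gt_eqF.
  by rewrite -sx; field.
rewrite (@continuous_FTC2 _ _ F)//.
- rewrite /F sqrrN subrr sqrtr0 !mulr0 !add0r mulNr divff ?gt_eqF//.
  by rewrite asin_pihalf asinN_pihalf -EFinB; congr EFin; lra.
- by apply: continuous_subspaceT => x; apply: cvgM; [exact: cvg_cst|exact: cs].
- have [_ Fa Fb] := (continuous_within_itvP _ aa).1 cF.
  by split=> // x /dF[].
- by move=> x /dF dFx; rewrite derive1E derive_val.
Qed.

End Disc.

(** * The image of planar Lebesgue measure under r^2 *)

Section Pushforward.
Context {R : realType}.
Local Notation mu := (@lebesgue_measure R).
Local Notation plane := (measurableTypeR R * measurableTypeR R)%type.

Definition rsq (p : plane) : measurableTypeR R := p.1 ^+ 2 + p.2 ^+ 2.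

Lemma measurable_rsq : measurable_fun setT rsq.
Proof.
by apply: measurable_funD; apply: measurable_funX;
  [exact: measurable_fst|exact: measurable_snd].
Qed.

(** The disc is sliced by vertical lines. The maximum covers negative q, where the set is empty. *)
Lemma leb2_disc (q : R) :
  leb2 (rsq @^-1` `]-oo, q]%classic) = (pi * Num.max 0 q)%:E.
Proof.
(* Since [Num.sqrt] is 0 on negative numbers, one formula also covers the empty slices. *)
have m2E x : mu (xsection (rsq @^-1` `]-oo, q]%classic) x) =
    (2 * Num.sqrt (q - x ^+ 2))%:E.
  have [xq|qx] := lerP (x ^+ 2) q; last first.
    rewrite ltr0_sqrtr ?subr_lt0// mulr0 (_ : xsection _ _ = set0) ?measure0//.
    apply/seteqP; split=> // y; rewrite /xsection/= inE/= in_itv/= /rsq/= => h.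
    by have := sqr_ge0 (y : R); lra.
  have -> : xsection (rsq @^-1` `]-oo, q]%classic) x =
      `[- Num.sqrt (q - x ^+ 2), Num.sqrt (q - x ^+ 2)]%classic.
    apply/seteqP; split=> y; rewrite /xsection/= inE/= !in_itv/= /rsq/= -ler_norml.
      by move=> h; rewrite -sqrtr_sqr ler_wsqrtr// lerBrDl.
    by rewrite -lerBrDl -sqrtr_sqr ler_sqrt ?subr_ge0.
  rewrite lebesgue_measure_itv/= lte_fin -EFinB.
  case: ltrP; first by move=> _; congr EFin; ring.
  by have := sqrtr_ge0 (q - x ^+ 2) => h1 h2; congr EFin; lra.
have -> : leb2 (rsq @^-1` `]-oo, q]%classic) = (\int[mu]_x (2 * Num.sqrt (q - x ^+ 2))%:E)%E.
  rewrite /leb2 /product_measure1; apply: eq_integral => x _.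
  exact: m2E.
have [q0|q0] := leP q 0.
  rewrite mulr0 integral0_eq// => x _; rewrite ler0_sqrtr ?mulr0//.
  by rewrite subr_le0 (le_trans q0)// sqr_ge0.
have a0 : 0 < Num.sqrt q by rewrite sqrtr_gt0.
have := half_chord_integral _ a0; rewrite sqr_sqrtr ?(ltW q0)// => <-.
rewrite [RHS]integral_mkcond; apply: eq_integral => x _.
rewrite patchE; case: ifPn => //; rewrite notin_setE/= in_itv/= -ler_norml => /negP.
rewrite -ltNge => qx; rewrite ltr0_sqrtr ?mulr0// subr_lt0.
by rewrite -[ltRHS]real_normK ?num_real// -[ltLHS]sqr_sqrtr ?ltW// ltr_pXn2r// nnegrE ?ltW.
Qed.

(** With q = r^2, dx dy = r dr dtheta becomes pi dq once the angle is integrated out. By uniqueness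
    of Lebesgue measure it is enough to compare half-open intervals, whose preimages are differences
    of two discs. *)
Lemma leb2_rsq (A : set (measurableTypeR R)) : measurable A -> A `<=` `[0, +oo[ ->
  leb2 (rsq @^-1` A) = (pi%:E * mu A)%E.
Proof.
move=> mA A0.
have pin : 0 <= pi^-1 :> R by rewrite invr_ge0 pi_ge0.
have mN : measurable (`]-oo, 0%R[%classic : set (measurableTypeR R)).
  exact: measurable_itv.
have mpre (q : R) : measurable (rsq @^-1` `]-oo, q]%classic).
  by rewrite -[_ @^-1` _]setTI; apply: measurable_rsq => //; exact: measurable_itv.
(* Lebesgue measure is put on the negative half-line, which [rsq] avoids, so that
   uniqueness on the whole line applies. *)
pose m := measure_add (mscale (NngNum pin) (pushforward leb2 rsq)) (mrestr mu mN).
have mE B : m measurable_rsq B =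
    ((pi^-1)%:E * leb2 (rsq @^-1` B) + mu (B `&` `]-oo, 0%R[%classic))%E.
  by rewrite /m measure_addE.
have mitv X : ocitv X -> mu X = m measurable_rsq X.
  move=> [[a b] _ <-]; rewrite mE/=.
  have [ba|ab] := leP b a.
    rewrite set_itv_ge ?bnd_simp -?leNgt// preimage_set0 set0I !measure0.
    by rewrite mule0 adde0.
  have -> : rsq @^-1` `]a, b]%classic =
      (rsq @^-1` `]-oo, b]%classic) `\` (rsq @^-1` `]-oo, a]%classic).
    apply/seteqP; split => p; rewrite /= !in_itv/=.
      by move=> /andP[ap pb]; split => //; apply/negP; rewrite -ltNge.
    by move=> [pb] /negP; rewrite -ltNge => ->.
  have fin : (leb2 (rsq @^-1` `]-oo, b]%classic) < +oo)%E by rewrite leb2_disc ltry.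
  have -> := @measureD _ _ _ leb2 _ _ (mpre b) (mpre a) fin.
  rewrite setIidr; last first.
    by move=> p; rewrite /= !in_itv/= => /le_trans; apply; exact: ltW.
  rewrite /= !leb2_disc -EFinB -mulrBr -EFinM mulKf ?gt_eqF ?pi_gt0//.
  rewrite lebesgue_measure_itv/= lte_fin ab -EFinB.
  (* Three positions of 0 relative to ]a, b]: the discs account for the nonnegative part of the
     interval, the restricted Lebesgue measure for the negative part. *)
  have [a0|a0] := leP 0 a.
    rewrite (_ : _ `&` _ = set0) ?measure0 ?adde0.
      by rewrite max_r// (le_trans a0)// ltW.
    apply/seteqP; split => // x; rewrite /= !in_itv/= => -[/andP[ax _]].
    by rewrite ltNge (le_trans a0)// ltW.
  have [b0|b0] := ltP b 0.
    rewrite setIidl; last first.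
      by move=> x; rewrite /= !in_itv/= => /andP[_ /le_lt_trans]; apply.
    by rewrite lebesgue_measure_itv/= lte_fin ab -!EFinB -EFinD; congr EFin; lra.
  rewrite (_ : _ `&` _ = `]a, 0[%classic).
    by rewrite lebesgue_measure_itv/= lte_fin a0 -!EFinB -EFinD; congr EFin; lra.
  apply/seteqP; split => x; rewrite /= !in_itv/=.
    by move=> [/andP[-> _]].
  by move=> /andP[-> x0]; rewrite x0 (le_trans (ltW x0)).
have -> : mu A = m measurable_rsq A := lebesgue_measure_unique mitv mA.
rewrite mE (_ : _ `&` _ = set0) ?measure0 ?adde0 ?muleA -?EFinM
  ?divff ?mul1e ?gt_eqF ?pi_gt0//.
apply/seteqP; split => // x [/A0]; rewrite /= !in_itv/= andbT => x0.
by rewrite ltNge x0.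
Qed.

End Pushforward.

(** * Integration of functions of r^2 over cylinders *)

Section Cylinder.
Context {R : realType}.
Local Notation mu := (@lebesgue_measure R).

Lemma cylinder_integral (z h : R) (D : set (measurableTypeR R)) (f : R -> \bar R) :
  0 <= h -> measurable D -> D `<=` `]0, +oo[ ->
  measurable_fun D f -> (forall q, D q -> (0 <= f q)%E) ->
  (\int[leb3]_(p in [set p : triple R | D (rsq p.1) /\ `](z - h)%R, (z + h)%R[%classic p.2])
     f (rsq p.1) = (2 * h * pi)%R%:E * \int[mu]_(q in D) f q)%E.
Proof.
move=> h0 mD D0 mf f0.
pose I : set (measurableTypeR R) := `]z - h, z + h[%classic.
have mI : measurable I by exact: measurable_itv.
(* [phi] sends everything outside the slab to 0, which is not in [D]. *)
pose phi (p : triple R) : measurableTypeR R := rsq p.1 * \1_I p.2.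
have mphi : measurable_fun setT phi.
  apply: measurable_funM; first exact: measurableT_comp measurable_rsq measurable_fst.
  by apply: measurableT_comp measurable_snd; exact: measurable_indic.
have phiE A : A `<=` `]0, +oo[%classic -> phi @^-1` A = (rsq @^-1` A) `*` I.
  move=> A0; apply/seteqP; split => [p /= Ap|p [/= Ap Ip]]; last first.
    by rewrite /phi indicE mem_set// mulr1.
  have := A0 _ Ap; rewrite /= in_itv/= andbT.
  move: Ap; rewrite /phi indicE; case: (boolP (p.2 \in I)) => [|_]; last first.
    by rewrite mulr0 ltxx.
  by rewrite inE mulr1.
have h2 : 0 <= 2 * h * pi by rewrite !mulr_ge0// pi_ge0.
transitivity (\int[pushforward leb3 phi]_(q in D) f q)%E.
  rewrite (ge0_integral_pushforward mphi)//; last by move=> q; rewrite inE; exact: f0.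
  rewrite phiE//; apply: eq_integral => p; rewrite inE => -[/= _ pI].
  by rewrite /phi indicE mem_set// mulr1.
(* Both sides are now integrals of [f] over [D], so it remains to see that the two measures agree on
   measurable subsets of [D]. *)
rewrite -(ge0_integral_mscale _ mD (NngNum h2))//.
apply: eq_measure_integral => A mA AD.
have AA : A `<=` `]0, +oo[%classic by exact: subset_trans D0.
have mrA : measurable (rsq @^-1` A).
  by rewrite -[_ @^-1` _]setTI; exact: measurable_rsq.
suff e : pushforward leb3 phi A = ((2 * h * pi)%:E * mu A)%E by exact: e.
have -> : pushforward leb3 phi A = (leb2 (rsq @^-1` A) * mu I)%E.
  by rewrite /pushforward phiE//; exact: product_measure1E.
have -> : leb2 (rsq @^-1` A) = (pi%:E * mu A)%E.
  apply: leb2_rsq => //.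
  by move=> x /AA; rewrite /= !in_itv/= !andbT; exact: ltW.
rewrite lebesgue_measure_itv/= lte_fin -EFinB.
case: ifPn => [_|]; last first.
  rewrite -leNgt => hh; have -> : h = 0 by lra.
  by rewrite mulr0 mul0r mul0e mule0.
rewrite muleC muleA -EFinM; congr (_%:E * _)%E; ring.
Qed.

(** An antiderivative is ln q + q0 / q. The one-point interval is treated apart, because the
    fundamental theorem is applied with q0 < Q. *)
Lemma layer_integral (q0 Q : R) : 0 < q0 -> q0 <= Q ->
  (\int[mu]_(q in `[q0, Q]) ((q - q0) / q ^+ 2)%:E =
   (ln (Q / q0) - 1 + q0 / Q)%:E)%E.
Proof.
move=> q0_gt0; rewrite le_eqVlt => /predU1P[<-|q0Q].
  by rewrite set_itv1 integral_set1 divff ?gt_eqF// ln1 sub0r addNr.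
pose F q := ln q + q0 * q^-1.
have dF (q : R) : 0 < q -> is_derive q 1 F ((q - q0) / q ^+ 2).
  move=> qp; have dl := is_derive1_ln qp.
  have di : is_derive q 1 (fun q : R => q^-1) (- q ^- 2 *: 1).
    by apply: (@is_deriveV R idfun); rewrite gt_eqF.
  apply: is_derive_eq; rewrite /GRing.scale/=.
  by field; rewrite gt_eqF.
have cont (g : R -> R) : (forall q : R, 0 < q -> {for q, continuous g}) ->
    {within `[q0, Q], continuous g}.
  move=> cg; apply: continuous_in_subspaceT => q; rewrite inE/= in_itv/= => /andP[q0q _].
  by apply: cg; exact: lt_le_trans q0q.
rewrite (@continuous_FTC2 _ _ F)//.
- rewrite /F -EFinB; congr EFin; rewrite lnM ?posrE ?invr_gt0 ?(lt_trans _ q0Q)// lnV ?posrE//.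
  by field; rewrite !gt_eqF// (lt_trans _ q0Q).
- apply: cont => q qp; apply: cvgM; first by apply: cvgB; [exact: cvg_id|exact: cvg_cst].
  apply: cvgV; first by rewrite gt_eqF// exprn_gt0.
  exact: exprn_continuous.
- have cF : {within `[q0, Q], continuous F}.
    apply: cont => q qp; have [dq _] := dF q qp.
    exact/differentiable_continuous/derivable1_diffP.
  have [_ Fa Fb] := (continuous_within_itvP _ q0Q).1 cF.
  split=> // x; rewrite in_itv/= => /andP[q0x _].
  by have [] := dF x (lt_trans q0_gt0 q0x).
- move=> x; rewrite in_itv/= => /andP[q0x _]; rewrite derive1E.
  have := dF x (lt_trans q0_gt0 q0x) => d; exact: derive_val.
Qed.

End Cylinder.

(** * Rotations around the axis *)

Section Rotation.
Context {R : realType}.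
Local Notation V := 'rV[R]_3.

Lemma vec3_ext (v w : V) : v 0 0 = w 0 0 -> v 0 1 = w 0 1 -> v 0 2%R = w 0 2%R -> v = w.
Proof.
move=> h0 h1 h2; apply/rowP => -[[|[|[|//]]] j3].
- by rewrite (_ : Ordinal _ = 0)//; exact: val_inj.
- by rewrite (_ : Ordinal _ = 1)//; exact: val_inj.
- by rewrite (_ : Ordinal _ = 2%R)//; exact: val_inj.
Qed.

Lemma sum3E (f : 'I_3 -> R) : \sum_(i < 3) f i = f 0 + f 1 + f 2%R.
Proof.
rewrite !big_ord_recr big_ord0 /= add0r; congr (f _ + f _ + f _); exact: val_inj.
Qed.

(** Rotation by the angle t about the z-axis, applied below to points and to velocities alike.
    Splitting off cos t and sin t as scalar factors makes the derivative in t immediate. *)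
Definition rotz (v : V) (t : R) : V :=
  cos t *: vec3 (v 0 0) (v 0 1) 0 + sin t *: vec3 (- v 0 1) (v 0 0) 0 + vec3 0 0 (v 0 2%R).

Lemma rotz0 v : rotz v 0 = v.
Proof.
rewrite /rotz cos0 sin0 scale0r addr0 scale1r.
by apply: vec3_ext; rewrite !mxE/= ?addr0 ?add0r.
Qed.

Lemma is_diff_rotz0 v :
  is_diff (0 : R) (rotz v) (fun t : R => t *: vec3 (- v 0 1) (v 0 0) 0).
Proof.
have dc : differentiable (@cos R) (0 : R) by exact/derivable1_diffP/derivable_cos.
have ds : differentiable (@sin R) (0 : R) by exact/derivable1_diffP/derivable_sin.
have dca := differentiableZl (vec3 (v 0 0) (v 0 1) 0) dc.
have dsa := differentiableZl (vec3 (- v 0 1) (v 0 0) 0) ds.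
have dcv z : 'd (@cos R) (0 : R) z = 0.
  by rewrite diff1E// derive1E derive_val sin0 oppr0 scaler0.
have dsv z : 'd (@sin R) (0 : R) z = z.
  by rewrite diff1E// derive1E derive_val cos0; exact: mulr1.
have h1 : is_diff (0 : R) (fun z : R => cos z *: vec3 (v 0 0) (v 0 1) 0)
    (fun z : R => 'd cos (0 : R) z *: vec3 (v 0 0) (v 0 1) 0).
  by apply: DiffDef dca _; rewrite (diffZl _ dc).
have h2 : is_diff (0 : R) (fun z : R => sin z *: vec3 (- v 0 1) (v 0 0) 0)
    (fun z : R => 'd sin (0 : R) z *: vec3 (- v 0 1) (v 0 0) 0).
  by apply: DiffDef dsa _; rewrite (diffZl _ ds).
have h3 := is_diffD (is_diffD h1 h2) (is_diff_cst (vec3 0 0 (v 0 2%R)) (0 : R)).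
apply: is_diff_eq h3 _.
apply/funext => z; rewrite !fctE addr0.
by rewrite [X in X *: _ + _]dcv [X in _ + X *: _]dsv scale0r add0r.
Qed.

Lemma comp_rE (v : V -> V) x :
  comp_r v x = (v x 0 0 * x 0 0 + v x 0 1 * x 0 1) / raxis x.
Proof. by rewrite /comp_r /dotv sum3E !mxE/=; ring. Qed.

Lemma comp_thetaE (v : V -> V) x :
  comp_theta v x = (v x 0 1 * x 0 0 - v x 0 0 * x 0 1) / raxis x.
Proof. by rewrite /comp_theta /dotv sum3E !mxE/=; ring. Qed.

Lemma comp_zE (v : V -> V) x : comp_z v x = v x 0 2%R.
Proof. by rewrite /comp_z /dotv sum3E !mxE/=; ring. Qed.

Lemma raxis_sq (x : V) : raxis x ^+ 2 = x 0 0 ^+ 2 + x 0 1 ^+ 2.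
Proof. by rewrite sqr_sqrtr// addr_ge0 ?sqr_ge0. Qed.

(** A rotation preserves r and z, hence the cylindrical components of the field, while the frame
    turns by t. Solving for the Cartesian entries gives equivariance. *)
Lemma axisymmetric_rotz (v : V -> V) x t : axisymmetric v -> 0 < raxis x ->
  v (rotz x t) = rotz (v x) t.
Proof.
move=> av x0.
have ct := cos2Dsin2 t.
have y0 : rotz x t 0 0 = cos t * x 0 0 - sin t * x 0 1 by rewrite !mxE/=; ring.
have y1 : rotz x t 0 1 = cos t * x 0 1 + sin t * x 0 0 by rewrite !mxE/=; ring.
have y2 : rotz x t 0 2%R = x 0 2%R by rewrite !mxE/=; ring.
have ry : raxis x = raxis (rotz x t).
  rewrite /raxis y0 y1; congr Num.sqrt.
  rewrite -[LHS]mul1r -ct; ring.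
have [|] := av x (rotz x t) x0 ry; first by rewrite /zcoord y2.
rewrite !comp_rE !comp_thetaE !comp_zE -ry y0 y1.
have rV0 : (raxis x)^-1 != 0 by rewrite invr_eq0 gt_eqF.
move=> /(mulIf rV0) er /(mulIf rV0) et ez.
have r2 : 0 < raxis x ^+ 2 by rewrite exprn_gt0.
have rn0 : raxis x ^+ 2 != 0 by rewrite gt_eqF.
set w := v (rotz x t) in er et ez *.
(* The horizontal entries of [w] are rebuilt from its radial and angular components at the rotated
   point, with denominators cleared by r^2. *)
have w0 : raxis x ^+ 2 * w 0 0 = raxis x ^+ 2 * (cos t * v x 0 0 - sin t * v x 0 1).
  transitivity (w 0 0 * ((cos t * x 0 0 - sin t * x 0 1) ^+ 2 +
      (cos t * x 0 1 + sin t * x 0 0) ^+ 2)).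
    by rewrite raxis_sq mulrC; congr (_ * _); rewrite -[LHS]mul1r -ct; ring.
  transitivity ((v x 0 0 * x 0 0 + v x 0 1 * x 0 1) * (cos t * x 0 0 - sin t * x 0 1)
     - (v x 0 1 * x 0 0 - v x 0 0 * x 0 1) * (cos t * x 0 1 + sin t * x 0 0)).
    by rewrite er et; ring.
  by rewrite raxis_sq; ring.
have w1 : raxis x ^+ 2 * w 0 1 = raxis x ^+ 2 * (cos t * v x 0 1 + sin t * v x 0 0).
  transitivity (w 0 1 * ((cos t * x 0 0 - sin t * x 0 1) ^+ 2 +
      (cos t * x 0 1 + sin t * x 0 0) ^+ 2)).
    by rewrite raxis_sq mulrC; congr (_ * _); rewrite -[LHS]mul1r -ct; ring.
  transitivity ((v x 0 0 * x 0 0 + v x 0 1 * x 0 1) * (cos t * x 0 1 + sin t * x 0 0)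
     + (v x 0 1 * x 0 0 - v x 0 0 * x 0 1) * (cos t * x 0 0 - sin t * x 0 1)).
    by rewrite er et; ring.
  by rewrite raxis_sq; ring.
apply: vec3_ext.
- by rewrite (mulfI rn0 w0) !mxE/=; ring.
- by rewrite (mulfI rn0 w1) !mxE/=; ring.
- by rewrite -ez !mxE/=; ring.
Qed.

Lemma axisymmetric_diff_rot (v : V -> V) x : axisymmetric v -> 0 < raxis x ->
  differentiable v x ->
  'd v x (vec3 (- x 0 1) (x 0 0) 0) = vec3 (- v x 0 1) (v x 0 0) 0.
Proof.
move=> av x0 dv.
have dv0 : is_diff (rotz x 0) v ('d v x) by rewrite rotz0; exact: DiffDef.
have h := is_diff_comp (is_diff_rotz0 x) dv0.
have h' := is_diff_rotz0 (v x).
have e : v \o rotz x = rotz (v x) by apply/funext => t; exact: axisymmetric_rotz.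
rewrite e in h.
have := etrans (esym (@diff_val _ _ _ _ _ _ _ h)) (@diff_val _ _ _ _ _ _ _ h').
by move=> /(congr1 (fun f => f 1)); rewrite /= !scale1r.
Qed.

(** Here [aij] is entry j of the derivative in direction i. Cauchy-Schwarz is used three times: to
    bound the angular component of w by |w|, and on each of the two rotation identities. The
    remaining entries only add squares. *)
Lemma rotation_derivative_ineq (r2 x0 x1 w0 w1 a00 a01 a02 a10 a11 a12 a20 a21 a22 : R) :
  0 < r2 -> r2 = x0 ^+ 2 + x1 ^+ 2 ->
  - x1 * a00 + x0 * a10 = - w1 -> - x1 * a01 + x0 * a11 = w0 ->
  (w1 * x0 - w0 * x1) ^+ 2 / r2 / r2 <=
  (a00 * a00 + a01 * a01 + a02 * a02) + (a10 * a10 + a11 * a11 + a12 * a12)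
  + (a20 * a20 + a21 * a21 + a22 * a22).
Proof.
move=> r2_gt0 r2E e0 e1.
have cs (a b c d : R) : (a * b + c * d) ^+ 2 <= (a ^+ 2 + c ^+ 2) * (b ^+ 2 + d ^+ 2).
  by rewrite -subr_ge0 [leRHS](_ : _ = (a * d - c * b) ^+ 2) ?sqr_ge0//; ring.
have h : (w1 * x0 - w0 * x1) ^+ 2 <= r2 * (w0 ^+ 2 + w1 ^+ 2).
  have := cs x0 w1 (- x1) w0; rewrite sqrrN -r2E [w1 ^+ 2 + _]addrC.
  by rewrite (_ : x0 * w1 + - x1 * w0 = w1 * x0 - w0 * x1)//; ring.
have h0 := cs (- x1) a00 x0 a10; have h1 := cs (- x1) a01 x0 a11.
rewrite e0 sqrrN sqrrN [_ + x0 ^+ 2]addrC -r2E in h0.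
rewrite e1 sqrrN [_ + x0 ^+ 2]addrC -r2E in h1.
rewrite !ler_pdivrMr//.
apply: (le_trans h); rewrite [leRHS]mulrC ler_pM2l//.
have -> : w0 ^+ 2 + w1 ^+ 2 = w1 ^+ 2 + w0 ^+ 2 by rewrite addrC.
apply: (le_trans (lerD h0 h1)); rewrite -mulrDr mulrC ler_pM2r//.
have := (sqr_ge0 a02, sqr_ge0 a12, sqr_ge0 a20, sqr_ge0 a21, sqr_ge0 a22).
by move=> [[[[]]]]; rewrite -!expr2; lra.
Qed.

Lemma normsq_ge0 (w : V) : 0 <= normsq w.
Proof. by apply: sumr_ge0 => i _; rewrite -expr2 sqr_ge0. Qed.

Lemma gradsq_ge0 (v : V -> V) x : 0 <= gradsq v x.
Proof. by apply: sumr_ge0 => j _; exact: normsq_ge0. Qed.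

Lemma comp_theta_sq_le_gradsq (v : V -> V) x : axisymmetric v ->
  differentiable v x -> comp_theta v x ^+ 2 / raxis x ^+ 2 <= gradsq v x.
Proof.
move=> av dv.
have g0 := gradsq_ge0 v x.
have [x0|x0] := ltP 0 (raxis x); last first.
  (* On the axis the left-hand side is 0 by the convention on division. *)
  have -> : raxis x = 0 by apply/eqP; rewrite eq_le x0 sqrtr_ge0.
  by rewrite expr0n invr0 mulr0.
have r2 : 0 < raxis x ^+ 2 by rewrite exprn_gt0.
have := axisymmetric_diff_rot _ _ av x0 dv.
have -> : vec3 (- x 0 1) (x 0 0) 0 = (- x 0 1) *: Defs.basis 0 + x 0 0 *: Defs.basis 1.
  by apply: vec3_ext; rewrite !mxE/=; ring.
rewrite linearD !linearZ/= -!deriveE// => e.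
have key (a0 a1 a2 w : V) :
    (- x 0 1) *: a0 + x 0 0 *: a1 = vec3 (- w 0 1) (w 0 0) 0 ->
    (w 0 1 * x 0 0 - w 0 0 * x 0 1) ^+ 2 / raxis x ^+ 2 / raxis x ^+ 2 <=
    normsq a0 + normsq a1 + normsq a2.
  move=> e'.
  have e0 := congr1 (fun w : V => w 0 0) e'.
  have e1 := congr1 (fun w : V => w 0 1) e'.
  rewrite /= !mxE/= in e0 e1.
  rewrite /normsq /dotv !sum3E.
  exact: rotation_derivative_ineq r2 (raxis_sq x) e0 e1.
rewrite comp_thetaE expr_div_n /gradsq sum3E.
exact: key e.
Qed.

End Rotation.

(** * Integrals over balls *)

Section Integrals.
Context {R : realType}.
Local Notation mu := (@lebesgue_measure R).
Local Notation V := 'rV[R]_3.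
Implicit Types (v : V -> V) (c : V) (rho : R).

Lemma continuous_normsq (f : V -> V) : continuous f -> continuous (fun x => normsq (f x)).
Proof.
move=> cf.
have cfi i : continuous (fun x => f x 0 i).
  move=> x; apply: (@continuous_comp _ _ _ f (fun M : V => M 0 i)); first exact: cf.
  exact: coord_continuous.
have -> : (fun x => normsq (f x)) =
    (fun x => f x 0 0 * f x 0 0 + f x 0 1 * f x 0 1 + f x 0 2%R * f x 0 2%R).
  by apply/funext => x; rewrite /normsq /dotv sum3E.
have cm i : continuous (fun x => f x 0 i * f x 0 i).
  by move=> x; exact: cvgM (cfi i x) (cfi i x).
by move=> x; exact: cvgD (cvgD (cm 0 x) (cm 1 x)) (cm 2%R x).
Qed.

Lemma continuous_gradsq v : (forall w, continuous ('D_w v)) -> continuous (gradsq v).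
Proof.
move=> cD.
have -> : gradsq v = (fun x => normsq ('D_(Defs.basis 0) v x) +
    normsq ('D_(Defs.basis 1) v x) + normsq ('D_(Defs.basis 2) v x)).
  by apply/funext => x; rewrite /gradsq sum3E.
have cn w : continuous (fun x => normsq ('D_w v x)) by exact: continuous_normsq.
by move=> x; exact: cvgD (cvgD (cn _ x) (cn _ x)) (cn _ x).
Qed.

Lemma continuous_raxis : continuous (@raxis R).
Proof.
move=> x; apply: (@continuous_comp _ _ _ (fun x : V => x 0 0 ^+ 2 + x 0 1 ^+ 2) Num.sqrt).
  have cm i : continuous (fun x : V => x 0 i ^+ 2).
    move=> y; apply: (@continuous_comp _ _ _ (fun x : V => x 0 i) (fun a => a ^+ 2)).
      exact: coord_continuous.
    exact: exprn_continuous.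
  exact: cvgD (cm 0 x) (cm 1 x).
exact: sqrt_continuous.
Qed.

Lemma measurable_eball c (rho : R) :
  measurable (of_triple @^-1` eball c rho : set (triple R)).
Proof.
apply: open_measurable_of_triple.
have -> : eball c rho = (fun x => normsq (x - c)) @^-1` `]-oo, rho ^+ 2[%classic.
  by apply/seteqP; split => x; rewrite /eball/= in_itv.
have /continuousP : continuous (fun x : V => normsq (x - c)).
  apply: continuous_normsq => x.
  by apply: continuousB; [exact: cvg_id|exact: cst_continuous].
by apply; exact: interval_open.
Qed.

Lemma eball_coord c rho x i : 0 < rho -> eball c rho x -> `|x 0 i - c 0 i| < rho.
Proof.
move=> rho0; rewrite /eball/= /normsq /dotv => h.
rewrite -(@ltr_pXn2r _ 2)// ?nnegrE ?ltW// real_normK ?num_real//.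
apply: le_lt_trans h; rewrite (bigD1 i)//= !mxE -expr2 lerDl.
by apply: sumr_ge0 => j _; rewrite -expr2 sqr_ge0.
Qed.

(** The ball lies in the closed cube [K], which is compact and of finite volume, so f is at most its
    maximum over [K]. *)
Lemma eintegral3_eball_lty c (rho : R) (f : V -> R) : 0 < rho -> continuous f ->
  (forall x, 0 <= f x) -> (eintegral3 (eball c rho) f < +oo)%E.
Proof.
move=> rho0 cf f0.
pose K : set V := [set x | forall i, x ord0 i \in `[c 0 i - rho, c 0 i + rho]].
have cK : compact K.
  apply: (@rV_compact _ _ (fun i => `[c 0 i - rho, c 0 i + rho]%classic)) => i.
  exact: segment_compact.
have K0 : K !=set0 by exists c => i; rewrite in_itv/=; apply/andP; split; lra.
have [m _ fc] : exists2 m, m \in K & forall x, x \in K -> f x <= f m.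
  by apply: EVT_max_rV => //; exact: continuous_subspaceT.
have BK : eball c rho `<=` K.
  move=> x Bx i; have := eball_coord _ _ _ i rho0 Bx.
  by rewrite in_itv/= ltr_norml => /andP[? ?]; apply/andP; split; rewrite ?ord1; lra.
pose I i : set (measurableTypeR R) := `[c 0 i - rho, c 0 i + rho]%classic.
have Ioo i : (mu (I i) < +oo)%E.
  by rewrite lebesgue_measure_itv/=; case: ifP => // _; rewrite -EFinB ltry.
have mI i : measurable (I i) by exact: measurable_itv.
have mB := measurable_eball c rho.
apply: (@le_lt_trans _ _ (\int[leb3]_(p in of_triple @^-1` eball c rho) (f m)%:E)%E).
  apply: ge0_le_integral => //.
  - by move=> p _; rewrite lee_fin.
  - apply/measurable_EFinP; apply: measurable_funTS.
    exact: continuous_measurable_of_triple.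
  - by move=> p Bp; rewrite lee_fin; apply: fc; rewrite inE; exact: BK.
rewrite integral_cst//; apply: lte_mul_pinfty; rewrite ?lee_fin//.
apply: (@le_lt_trans _ _ (leb3 ((I 0%R `*` I 1%R) `*` I 2%R))).
  apply: le_measure; rewrite ?inE//.
    by apply: measurableX => //; exact: measurableX.
  move=> [[a b] d] /BK; rewrite /K/= => h.
  by have := (h 0, h 1, h 2%R); rewrite !mxE/= => -[[]].
have -> : leb3 ((I 0 `*` I 1) `*` I 2%R) = (leb2 (I 0%R `*` I 1%R) * mu (I 2%R))%E.
  by apply: product_measure1E => //; exact: measurableX.
have -> : leb2 (I 0 `*` I 1) = (mu (I 0%R) * mu (I 1%R))%E by exact: product_measure1E.
have fI i : mu (I i) \is a fin_num by rewrite ge0_fin_numE ?measure_ge0.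
by rewrite ltey_eq !fin_numM.
Qed.

End Integrals.

(** * Null sets: the axis and the exceptional set of the circulation bound *)

Section AlmostEverywhere.
Context {R : realType}.
Local Notation mu := (@lebesgue_measure R).
Local Notation V := 'rV[R]_3.

Lemma lebesgue_measureT : mu setT = +oo%E.
Proof. by rewrite -set_itv_infty_infty lebesgue_measure_itv. Qed.

(** [Lnorm] at exponent +oo is the essential supremum only on a space of positive measure. *)
Lemma leb3_setT_gt0 : (0 < leb3 [set: triple R])%E.
Proof.
have -> : leb3 [set: triple R] = (leb2 setT * mu setT)%E.
  by rewrite -setXTT; exact: product_measure1E.
have -> : leb2 [set: (measurableTypeR R * measurableTypeR R)%type] = (mu setT * mu setT)%E.
  by rewrite -setXTT; exact: product_measure1E.
by rewrite lebesgue_measureT !mulyy ltry.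
Qed.

Lemma Linfty3_le_ae (f : V -> R) (G : R) : (Linfty3 f <= G%:E)%E ->
  {ae leb3, forall p : triple R, `|f (of_triple p)| <= G}.
Proof.
rewrite /Linfty3 unlock leb3_setT_gt0 => /ess_supP.
by apply: filterS => p /=; rewrite lee_fin.
Qed.

Lemma raxis_of_triple (p : triple R) : raxis (of_triple p) ^+ 2 = rsq p.1.
Proof. by rewrite raxis_sq !mxE. Qed.

(** The axis is the set r^2 = 0, and the pushforward formula gives a single value of r^2 planar
    measure 0. *)
Lemma ae_raxis_gt0 : {ae leb3, forall p : triple R, 0 < raxis (of_triple p)}.
Proof.
have m0 : measurable (rsq @^-1` [set 0 : R]).
  by rewrite -[_ @^-1` _]setTI; exact: measurable_rsq.
exists ((rsq @^-1` [set 0]) `*` setT); split.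
- exact: measurableX.
- have -> : leb3 ((rsq @^-1` [set 0 : R]) `*` setT) =
      (leb2 (rsq @^-1` [set (0 : R)%R]) * mu setT)%E by exact: product_measure1E.
  rewrite leb2_rsq//; last by move=> x ->; rewrite /= in_itv/= lexx.
  by rewrite lebesgue_measure_set1 mule0 mul0e.
- move=> p /= /negP; rewrite -leNgt => r0; split => //=.
  rewrite -raxis_of_triple; have -> : raxis (of_triple p) = 0.
    by apply/eqP; rewrite eq_le r0 sqrtr_ge0.
  by rewrite expr0n.
Qed.

(** Pythagoras in the orthonormal cylindrical frame, which exists only off the axis. In the proof
    [a] and [b] are the cosine and sine of the polar angle. *)
Lemma normsq_meridional (v : V -> V) x : 0 < raxis x ->
  normsq (v x) = normsq (meridional v x) + comp_theta v x ^+ 2.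
Proof.
move=> r0; have r2 := raxis_sq x.
have rn : raxis x != 0 by rewrite gt_eqF.
have e : (x 0 0 / raxis x) ^+ 2 + (x 0 1 / raxis x) ^+ 2 = 1.
  by rewrite !expr_div_n -mulrDl -r2 divff// expf_neq0.
rewrite /normsq /dotv !sum3E comp_thetaE /meridional comp_rE comp_zE !mxE/=.
move: (v x) => w.
set a := x 0 0 / raxis x in e *; set b := x 0 1 / raxis x in e *.
have -> : (w 0 0 * x 0 0 + w 0 1 * x 0 1) / raxis x = w 0 0 * a + w 0 1 * b.
  by rewrite /a /b; ring.
have -> : (w 0 1 * x 0 0 - w 0 0 * x 0 1) / raxis x = w 0 1 * a - w 0 0 * b.
  by rewrite /a /b; ring.
transitivity ((w 0 0 ^+ 2 + w 0 1 ^+ 2) * (a ^+ 2 + b ^+ 2) + w 0 2%R ^+ 2).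
  by rewrite e; ring.
transitivity ((w 0 0 * a + w 0 1 * b) ^+ 2 + (w 0 1 * a - w 0 0 * b) ^+ 2 + w 0 2%R ^+ 2).
  ring.
(* The squared radial component is multiplied by a^2 + b^2 = 1, the squared length of [e_r]. *)
rewrite -[X in X + _ + _]mulr1 -[X in _ * X + _ + _]e; ring.
Qed.

End AlmostEverywhere.

(** * The swirl component *)

Section Swirl.
Context {R : realType}.
Local Notation mu := (@lebesgue_measure R).
Local Notation V := 'rV[R]_3.

(** Inversion is not continuous at 0; writing it as x times a real power of x^2 gives measurability
    on the whole line, with the value 0 at 0. *)
Lemma measurable_invr : measurable_fun setT (@GRing.inv R : R -> R).
Proof.
have -> : (@GRing.inv R : R -> R) = (fun x => x * (x ^+ 2) `^ (-1)).
  apply/funext => x; rewrite powR_inv1 ?sqr_ge0//.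
  have [->|x0] := eqVneq x 0; first by rewrite invr0 mul0r.
  by field.
apply: measurable_funM; first exact: measurable_id.
exact: (measurableT_comp (@measurable_powR R (-1)) (@exprn_measurable R setT 2)).
Qed.

Lemma measurable_raxis_inv :
  measurable_fun setT (fun p : triple R => (raxis (of_triple p))^-1 : measurableTypeR R).
Proof.
apply: measurableT_comp; first exact: measurable_invr.
exact: continuous_measurable_of_triple (@continuous_raxis R).
Qed.

Lemma measurable_coord_of_triple i :
  measurable_fun setT (fun p : triple R => of_triple p 0 i : measurableTypeR R).
Proof.
exact: (continuous_measurable_of_triple (fun x : V => x 0 i) (@coord_continuous _ _ _ _ _)).
Qed.

(** * Estimates for one axisymmetric field on a ball centred on the axis *)

Section FixedField.
Context (v : V -> V) (G zs rho : R).
Context (av : axisymmetric v) (dv : forall x, differentiable v x).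
Context (cD : forall w, continuous ('D_w v)).
Context (hG : {ae leb3, forall p : triple R, `|circulation v (of_triple p)| <= G}).
Context (G0 : 0 < G) (rho0 : 0 < rho).
Let xs : V := vec3 0 0 zs.
Let B : set (triple R) := of_triple @^-1` eball xs rho.
Let cv : continuous v. Proof. by move=> x; exact: differentiable_continuous. Qed.

Let mvi i : measurable_fun setT (fun p : triple R => v (of_triple p) 0 i : measurableTypeR R).
Proof.
apply: (continuous_measurable_of_triple (fun x => v x 0 i)) => x.
apply: (@continuous_comp _ _ _ v (fun M : V => M 0 i)); first exact: cv.
exact: coord_continuous.
Qed.

Lemma measurable_comp_theta :
  measurable_fun setT (fun p : triple R => comp_theta v (of_triple p) : measurableTypeR R).
Proof.
under eq_fun do rewrite comp_thetaE.
apply: measurable_funM; last exact: measurable_raxis_inv.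
by apply: measurable_funB; apply: measurable_funM;
  [exact: mvi|exact: measurable_coord_of_triple|exact: mvi|exact: measurable_coord_of_triple].
Qed.

Lemma measurable_comp_r :
  measurable_fun setT (fun p : triple R => comp_r v (of_triple p) : measurableTypeR R).
Proof.
under eq_fun do rewrite comp_rE.
apply: measurable_funM; last exact: measurable_raxis_inv.
by apply: measurable_funD; apply: measurable_funM;
  [exact: mvi|exact: measurable_coord_of_triple|exact: mvi|exact: measurable_coord_of_triple].
Qed.

Lemma measurable_normsq_meridional : measurable_fun setT
  (fun p : triple R => normsq (meridional v (of_triple p)) : measurableTypeR R).
Proof.
have e p : normsq (meridional v (of_triple p)) =
    (comp_r v (of_triple p) * (of_triple p 0 0 * (raxis (of_triple p))^-1)) ^+ 2 +
    (comp_r v (of_triple p) * (of_triple p 0 1 * (raxis (of_triple p))^-1)) ^+ 2 +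
    v (of_triple p) 0 2%R ^+ 2.
  move: (of_triple p) => x.
  by rewrite /normsq /dotv sum3E /meridional comp_zE !mxE/=; move: (v x) => w; ring.
under eq_fun do rewrite e.
have mc i : measurable_fun setT (fun p : triple R =>
    (comp_r v (of_triple p) * (of_triple p 0 i * (raxis (of_triple p))^-1)) ^+ 2
    : measurableTypeR R).
  apply: measurable_funX; apply: measurable_funM; first exact: measurable_comp_r.
  by apply: measurable_funM; [exact: measurable_coord_of_triple|exact: measurable_raxis_inv].
apply: measurable_funD; first exact: measurable_funD (mc 0) (mc 1).
by apply: measurable_funX; exact: mvi.
Qed.

Let g x := comp_theta v x ^+ 2 / raxis x ^+ 2.
Let g0 x : 0 <= g x.
Proof. by rewrite /g mulr_ge0 ?sqr_ge0// invr_ge0 sqr_ge0. Qed.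

Lemma measurable_angular_density :
  measurable_fun setT (fun p : triple R => g (of_triple p) : measurableTypeR R).
Proof.
rewrite /g; under eq_fun do rewrite -exprVn.
apply: measurable_funM; apply: measurable_funX; first exact: measurable_comp_theta.
exact: measurable_raxis_inv.
Qed.

Lemma measurable_gradsq :
  measurable_fun setT (fun p : triple R => gradsq v (of_triple p) : measurableTypeR R).
Proof. exact: continuous_measurable_of_triple (continuous_gradsq _ cD). Qed.

Lemma eintegral3_D_le_gradsq :
  (eintegral3 (eball xs rho) g <= eintegral3 (eball xs rho) (gradsq v))%E.
Proof.
apply: ge0_le_integral.
- exact: measurable_eball.
- by move=> p _; rewrite lee_fin mulr_ge0 ?sqr_ge0// invr_ge0 sqr_ge0.
- by apply/measurable_EFinP/measurable_funTS; exact: measurable_angular_density.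
- by apply/measurable_EFinP/measurable_funTS; exact: measurable_gradsq.
- by move=> p _; rewrite lee_fin; exact: comp_theta_sq_le_gradsq.
Qed.

(** The factor 1 / r^2 is controlled near the axis by the squared gradient, which is continuous. *)
Lemma eintegral3_D_lty : (eintegral3 (eball xs rho) g < +oo)%E.
Proof.
apply: le_lt_trans eintegral3_D_le_gradsq _.
apply: eintegral3_eball_lty => //; first exact: continuous_gradsq.
exact: gradsq_ge0.
Qed.

(* Below radius sqrt q0 the swirl is charged to the dissipation density [g],
   above it the excess r^2 - q0 is charged to the circulation bound g <= G^2 / r^4. *)
Lemma swirl_split x q0 : 0 < raxis x -> `|circulation v x| <= G ->
  comp_theta v x ^+ 2 <= q0 * g x +
    (if q0 <= raxis x ^+ 2 then G ^+ 2 * ((raxis x ^+ 2 - q0) / (raxis x ^+ 2) ^+ 2) else 0).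
Proof.
move=> r0 h; have r2 : 0 < raxis x ^+ 2 by rewrite exprn_gt0.
have -> : comp_theta v x ^+ 2 = raxis x ^+ 2 * g x.
  by rewrite /g mulrCA divff ?mulr1// gt_eqF.
case: ifPn => [qr|]; last first.
  by rewrite -ltNge addr0 => /ltW rq; rewrite ler_wpM2r.
have gG : g x <= G ^+ 2 / (raxis x ^+ 2) ^+ 2.
  rewrite ler_pdivlMr ?exprn_gt0//.
  have -> : g x * (raxis x ^+ 2) ^+ 2 = circulation v x ^+ 2.
    by rewrite /g /circulation; field; rewrite gt_eqF.
  by rewrite -real_normK ?num_real// ler_pXn2r// nnegrE ltW.
rewrite -lerBlDl -mulrBl [leRHS]mulrCA; apply: ler_wpM2l gG; lra.
Qed.

Lemma eball_cylinder (p : triple R) : B p ->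
  rsq p.1 < rho ^+ 2 /\ `](zs - rho), (zs + rho)[%classic p.2.
Proof.
move=> Bp; split.
  move: Bp; rewrite /B /eball /normsq /dotv/= sum3E !mxE/= !subr0 -!expr2 /rsq.
  by have := sqr_ge0 (p.2 - zs); lra.
have := @eball_coord _ xs rho (of_triple p) 2%R rho0 Bp.
by rewrite !mxE/= in_itv/= ltr_distl.
Qed.

(** The meridional energy is kept on the right, so that no extended reals are subtracted before
    finiteness is known. *)
Lemma eintegral3_normsq_split q0 : 0 < q0 -> q0 <= rho ^+ 2 ->
  (eintegral3 (eball xs rho) (fun x => normsq (v x)) <=
   eintegral3 (eball xs rho) (fun x => normsq (meridional v x)) +
   (q0%:E * eintegral3 (eball xs rho) g +
   (2 * rho * pi * (G ^+ 2 * (ln (rho ^+ 2 / q0) - 1 + q0 / rho ^+ 2)))%:E))%E.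
Proof.
move=> q0_gt0 q0rho.
have mB : measurable B by exact: measurable_eball.
pose D : set (measurableTypeR R) := `[q0, rho ^+ 2]%classic.
have mD : measurable D by exact: measurable_itv.
pose I : set (measurableTypeR R) := `](zs - rho), (zs + rho)[%classic.
pose C := [set p : triple R | D (rsq p.1) /\ I p.2].
have mC : measurable C.
  have -> : C = (rsq @^-1` D) `*` I by [].
  apply: measurableX; last exact: measurable_itv.
  by rewrite -[_ @^-1` _]setTI; exact: measurable_rsq.
pose h (q : R) : R := (q - q0) / q ^+ 2.
have mh : measurable_fun setT h.
  apply: measurable_funM; first exact: measurable_funB.
  exact: (measurableT_comp measurable_invr (@exprn_measurable R setT 2)).
have h0 q : D q -> 0 <= h q.
  rewrite /D/= in_itv/= => /andP[q0q _].
  by rewrite /h mulr_ge0 ?invr_ge0 ?sqr_ge0// subr_ge0.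
pose f q := (G ^+ 2 * h q)%:E.
have mf : measurable_fun setT f.
  by apply/measurable_EFinP; apply: measurable_funM.
have f0 q : D q -> (0 <= f q)%E.
  by move=> Dq; rewrite lee_fin mulr_ge0 ?sqr_ge0 ?h0.
(* [k] is the outer part of the swirl bound, extended by 0 outside the cylindrical shell; being
   nonnegative, it may be integrated over all of space instead of the ball. *)
pose k : triple R -> \bar R := (fun p => f (rsq p.1)) \_ C.
have mk : measurable_fun setT k.
  apply/(measurable_restrictT _ mC); apply: measurable_funTS.
  apply: measurableT_comp => //; apply: measurableT_comp; last exact: measurable_fst.
  exact: measurable_rsq.
have k0 p : (0 <= k p)%E.
  by rewrite /k patchE; case: ifPn => // /set_mem[/= Dp _]; exact: f0.
have kle : (\int[leb3]_(p in B) k p <=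
    (2 * rho * pi * (G ^+ 2 * (ln (rho ^+ 2 / q0) - 1 + q0 / rho ^+ 2)))%:E)%E.
  apply: (@le_trans _ _ (\int[leb3]_p k p)%E).
    by apply: ge0_subset_integral.
  rewrite -integral_mkcond /C (cylinder_integral zs rho D f)//; last 3 first.
  - exact: ltW.
  - by move=> q; rewrite /D/= !in_itv/= => /andP[/(lt_le_trans q0_gt0) -> _].
  - exact: measurable_funTS.
  under eq_integral do rewrite /f EFinM.
  rewrite ge0_integralZl_EFin ?sqr_ge0//; last first.
    by apply/measurable_EFinP; exact: measurable_funTS.
  by rewrite layer_integral// -!EFinM.
have nq0 := @normsq_ge0 R.
have mn : measurable_fun B (fun p => (normsq (v (of_triple p)))%:E).
  apply/measurable_EFinP/measurable_funTS.
  exact: (continuous_measurable_of_triple _ (continuous_normsq _ cv)).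
have mm : measurable_fun B (fun p => (normsq (meridional v (of_triple p)))%:E).
  by apply/measurable_EFinP/measurable_funTS; exact: measurable_normsq_meridional.
have mg : measurable_fun B (fun p => (g (of_triple p))%:E).
  by apply/measurable_EFinP/measurable_funTS; exact: measurable_angular_density.
have mqg : measurable_fun B (fun p => q0%:E * (g (of_triple p))%:E)%E.
  exact: emeasurable_funM.
have mkB : measurable_fun B k by exact: measurable_funTS.
have qg0 p : (0 <= q0%:E * (g (of_triple p))%:E)%E.
  by rewrite -EFinM lee_fin mulr_ge0// ltW.
apply: (@le_trans _ _ (\int[leb3]_(p in B) ((normsq (meridional v (of_triple p)))%:E +
    (q0%:E * (g (of_triple p))%:E + k p)))%E).
  (* The pointwise splitting holds off the axis and where the circulation bound is valid, hence
     almost everywhere. *)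
  apply: ae_ge0_le_integral => //.
  - by move=> p _; rewrite lee_fin.
  - by move=> p _; rewrite !adde_ge0// lee_fin.
  - by apply: emeasurable_funD => //; exact: emeasurable_funD.
  - apply: filterS2 hG (@ae_raxis_gt0 R) => p hp rp Bp.
    rewrite normsq_meridional// EFinD leeD2l//.
    apply: (@le_trans _ _ (q0 * g (of_triple p) + _)%:E).
      by rewrite lee_fin; exact: swirl_split rp hp.
    rewrite EFinD EFinM leeD2l// raxis_of_triple.
    case: ifPn => [q0r|_]; last exact: k0.
    have [rrho Ip] := eball_cylinder _ Bp.
    by rewrite /k patchE mem_set// /C/=; split => //; rewrite /D/= in_itv/= q0r ltW.
rewrite ge0_integralD//; last 3 first.
- by move=> p _; rewrite lee_fin.
- by move=> p _; exact: adde_ge0.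
- exact: emeasurable_funD.
rewrite leeD2l// ge0_integralD// ge0_integralZl_EFin ?(ltW q0_gt0)//.
  exact: leeD2l.
by move=> p _; rewrite lee_fin.
Qed.

Lemma eintegral3_meridional_lty :
  (eintegral3 (eball xs rho) (fun x => normsq (meridional v x)) < +oo)%E.
Proof.
have nq0 := @normsq_ge0 R.
apply: (@le_lt_trans _ _ (eintegral3 (eball xs rho) (fun x => normsq (v x)))); last first.
  by apply: eintegral3_eball_lty => //; exact: continuous_normsq.
apply: ae_ge0_le_integral.
- exact: measurable_eball.
- by move=> p _; rewrite lee_fin.
- by apply/measurable_EFinP/measurable_funTS; exact: measurable_normsq_meridional.
- by move=> p _; rewrite lee_fin.
- apply/measurable_EFinP/measurable_funTS.
  exact: (continuous_measurable_of_triple _ (continuous_normsq _ cv)).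
- apply: filterS (@ae_raxis_gt0 R) => p rp _.
  by rewrite (normsq_meridional v)// lee_fin lerDl sqr_ge0.
Qed.

Lemma swirl_log_bound (c := 2 * pi * G ^+ 2) :
  S_ v xs rho <= c * ln (1 + rho * D_theta v xs rho / c).
Proof.
have c0 : 0 < c by rewrite !mulr_gt0 ?pi_gt0// exprn_gt0.
have nq0 := @normsq_ge0 R.
have i0 (f : V -> R) : (forall x, 0 <= f x) -> (0 <= eintegral3 (eball xs rho) f)%E.
  by move=> f0; apply: integral_ge0 => p _; rewrite lee_fin.
have fin (f : V -> R) : (forall x, 0 <= f x) -> (eintegral3 (eball xs rho) f < +oo)%E ->
    eintegral3 (eball xs rho) f = (integral3 (eball xs rho) f)%:E.
  by move=> f0 foo; rewrite fineK// ge0_fin_numE// i0.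
have N0 : 0 <= integral3 (eball xs rho) (fun x => normsq (v x)).
  by apply: fine_ge0; exact: i0.
have d0 : 0 <= D_theta v xs rho by apply: fine_ge0; exact: i0.
rewrite /S_ /A_ /M_ sqr_sqrtr; last by rewrite mulr_ge0// invr_ge0 ltW.
(* The cut-off q0 = rho^2 / lam minimises the right-hand side of the splitting. With D = c (lam - 1)
   / rho, the term q0 D equals c rho (1 - 1 / lam) and cancels all of the layer term except c rho ln
   lam. *)
pose lam := 1 + rho * D_theta v xs rho / c.
have lam1 : 1 <= lam by rewrite lerDl divr_ge0 ?(ltW c0)// mulr_ge0// ltW.
have lam0 : 0 < lam by exact: lt_le_trans lam1.
have rho2 : 0 < rho ^+ 2 by rewrite exprn_gt0.
have q0_gt0 : 0 < rho ^+ 2 / lam by rewrite divr_gt0.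
have q0rho : rho ^+ 2 / lam <= rho ^+ 2.
  by rewrite ler_pdivrMr// ler_peMr// ltW.
have := eintegral3_normsq_split _ q0_gt0 q0rho.
rewrite (fin (fun x => normsq (v x)))//; last first.
  by apply: eintegral3_eball_lty => //; exact: continuous_normsq.
rewrite (fin (fun x => normsq (meridional v x)))//; last exact: eintegral3_meridional_lty.
rewrite (fin g)//; last exact: eintegral3_D_lty.
rewrite -!EFinM -!EFinD lee_fin -[integral3 _ g]/(D_theta v xs rho).
have -> : rho ^+ 2 / (rho ^+ 2 / lam) = lam by field; rewrite !gt_eqF.
have -> : rho ^+ 2 / lam / rho ^+ 2 = lam^-1 by field; rewrite !gt_eqF.
rewrite -lerBlDl -mulrBr => h.
rewrite mulrC ler_pdivrMr//; apply: (le_trans h).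
rewrite -/lam.
have cE : 2 * pi * G ^+ 2 = c by [].
have DE : D_theta v xs rho = c * (lam - 1) / rho.
  by rewrite /lam; field; rewrite !gt_eqF.
rewrite [X in X <= _](_ : _ = c * ln lam * rho)// DE.
rewrite [2 * rho * pi * _](_ : _ = c * rho * (ln lam - 1 + lam^-1)); last first.
  by rewrite -cE; ring.
by field; rewrite !gt_eqF.
Qed.

Lemma gradsq_lower_bound (c := 2 * pi * G ^+ 2) :
  c / rho * (expR (S_ v xs rho / c) - 1) <= integral3 (eball xs rho) (gradsq v).
Proof.
have c0 : 0 < c by rewrite !mulr_gt0 ?pi_gt0// exprn_gt0.
have gs0 := gradsq_ge0 v.
have d0 : 0 <= D_theta v xs rho.
  by apply: fine_ge0; apply: integral_ge0 => p _; rewrite lee_fin; exact: g0.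
have DE : D_theta v xs rho <= integral3 (eball xs rho) (gradsq v).
  (* Passing from the extended to the real inequality requires both integrals to be finite. *)
  apply: fine_le.
  - rewrite ge0_fin_numE ?eintegral3_D_lty//.
    by apply: integral_ge0 => p _; rewrite lee_fin; exact: g0.
  - rewrite ge0_fin_numE.
      by apply: eintegral3_eball_lty => //; exact: continuous_gradsq.
    by apply: integral_ge0 => p _; rewrite lee_fin; exact: gs0.
  - exact: eintegral3_D_le_gradsq.
apply: le_trans DE.
have h1 : 0 < 1 + rho * D_theta v xs rho / c.
  by rewrite ltr_pwDl// divr_ge0 ?(ltW c0)// mulr_ge0// ltW.
(* The logarithmic bound, exponentiated. *)
have : expR (S_ v xs rho / c) <= 1 + rho * D_theta v xs rho / c.
  rewrite -[leRHS]lnK ?posrE// ler_expR ler_pdivrMr// mulrC.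
  exact: swirl_log_bound.
rewrite -lerBlDl => h.
rewrite -[leRHS](_ : c / rho * (rho * D_theta v xs rho / c) = _); last first.
  by field; rewrite !gt_eqF.
by rewrite ler_pM2l// divr_gt0.
Qed.

End FixedField.
End Swirl.

Theorem proposition10p1 (R : realType) (nu T Gammas : R)
    (u : R -> 'rV[R]_3 -> 'rV[R]_3)
    (hu : NS_solution nu T u)
    (haxi : forall t : R, 0 <= t < T -> axisymmetric (u t))
    (hGammas : 0 < Gammas)
    (hGamma : forall t : R, 0 <= t < T ->
       (Linfty3 (circulation (u t)) <= Gammas%:E)%E)
    (zs rho : R) (hrho : 0 < rho) (t : R) (ht : regular_time T u t) :
  let xs := vec3 0 0 zs in
  let c := 2 * pi * Gammas ^+ 2 in
  S_ (u t) xs rho <= c * ln (1 + rho * D_theta (u t) xs rho / c) /\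
  integral3 (eball xs rho) (gradsq (u t)) >=
    c / rho * (expR ((A_ (u t) xs rho ^+ 2 - M_ (u t) xs rho) / c) - 1).
Proof.
have [t0T smooth_ut] := ht.
(* At order 1, smoothness unfolds to differentiability and continuity of every directional
   derivative. *)
have [dv cD] := smooth_ut 1%N.
have av := haxi t t0T.
have hG := Linfty3_le_ae _ _ (hGamma t t0T).
split; first exact: swirl_log_bound.
exact: gradsq_lower_bound.
Qed.
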